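(* Let $P=\{132,231\}$ and, for $n\ge1$ and $l\ge0$, let $c_{n,l}$ be the number of permutations of $\{1,\dots,n\}$ that are $(l+1)$-chains for $P$ (i.e. are obtained by linking $l$ occurrences of patterns from $P$). Then $c_{n,l}=0$ unless $n=2l+1$, and $c_{2l+1,l}=E_{2l+1}$, the tangent number. Consequently the exponential generating function of permutations avoiding both $132$ and $231$ is $$g_P(t)=\frac{1}{1-\tanh t}.$$
   Context: The tangent numbers $E_{2l+1}$ are defined by $\tan t=\sum_{l\ge0}E_{2l+1}\frac{t^{2l+1}}{(2l+1)!}$. For a word $s=s_1\dots s_j$ of distinct integers, $\mathrm{st}(s)$ is the permutation $\rho$ of $\{1,\dots,j\}$ with $s_i<s_r\iff\rho_i<\rho_r$; an occurrence of a pattern $\pi$ of length $j$ in a word $w$ is a factor $w_i\dots w_{i+j-1}$ with $\mathrm{st}(w_i\dots w_{i+j-1})=\pi$. $g_P(t)=1+\sum_{n\ge1}\frac{a^P_n}{n!}t^n$ with $a^P_n$ the number of permutations of $\{1,\dots,n\}$ with no occurrence of any pattern in $P$. Chains and tails: the empty word is a $0$-chain, its own tail; each one-letter word is a $1$-chain, its own tail; for $q\ge2$ a $q$-chain is a word $\sigma$ with a factorization $\sigma=\sigma'\tau$ where $\sigma'$ is a $(q-1)$-chain with tail $\tau'$ and $\tau'\tau$ contains exactly one occurrence of a pattern from $P$, this occurrence being a suffix of $\tau'\tau$; $\tau$ is the tail of $\sigma$.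
   Formalization: In the definition of a q-chain, the occurrence that is a suffix of τ'τ is also required to start inside the previous tail τ' (linking); without this 1243 = 1·243 would be a 2-chain and c_{4,1} would not be 0. *)

(* Defs.v *)
From mathcomp Require Import all_boot all_order all_algebra all_fingroup.
From mathcomp Require Import boolp.

Set Implicit Arguments.
Unset Strict Implicit.
Unset Printing Implicit Defensive.

Import Order.TTheory GRing.Theory Num.Theory.
Local Open Scope nat_scope.

Definition word := seq nat.

(* One-line word of the standardization. For words with distinct letters it is
   characterized by st_perm and st_mono below, see st_unique. *)
Definition st (s : word) : word :=
  [seq (count (fun y => y < x) s).+1 | x <- s].

(* The occurrence starts at the 0-based position i. *)
Definition occurs_at (p w : word) (i : nat) : bool :=
  (i + size p <= size w) && (st (take (size p) (drop i w)) == p).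

Definition avoids (P : seq word) (w : word) : Prop :=
  forall p i, p \in P -> ~~ occurs_at p w i.

(* t' ++ t contains exactly one occurrence of a pattern from P, and this
   occurrence is a suffix of t' ++ t. The condition i < size t' is what makes
   the new occurrence linked to the previous tail: it starts inside t', so that
   the tail t is a proper suffix of the occurrence. Without it 1243 would be a
   2-chain for {132, 231}, through t' = 1, t = 243, although its only occurrence
   243 does not meet the 1-chain 1. *)
Definition links (P : seq word) (t' t : word) : Prop :=
  exists p i,
    [/\ p \in P,
        occurs_at p (t' ++ t) i,
        i + size p = size (t' ++ t),
        i < size t' &
        forall p2 i2, p2 \in P -> occurs_at p2 (t' ++ t) i2 -> p2 = p /\ i2 = i].

(* chain_tail P q s t: s is a q-chain for P with tail t. *)
Inductive chain_tail (P : seq word) : nat -> word -> word -> Prop :=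
| chain_nil : chain_tail P 0 [::] [::]
| chain_letter x : chain_tail P 1 [:: x] [:: x]
| chain_link q s' t' t :
    0 < q -> chain_tail P q s' t' -> links P t' t ->
    chain_tail P q.+1 (s' ++ t) t.

Definition is_chain (P : seq word) (q : nat) (s : word) : Prop :=
  exists t, chain_tail P q s t.

Definition perm_word (n : nat) (s : 'S_n) : word :=
  [seq (s i : nat).+1 | i <- enum 'I_n].

Definition num_avoiding (P : seq word) (n : nat) : nat :=
  #|[set s : 'S_n | `[< avoids P (perm_word s) >]]|.

Definition num_chains (P : seq word) (q n : nat) : nat :=
  #|[set s : 'S_n | `[< is_chain P q (perm_word s) >]]|.

Definition P132_231 : seq word := [:: [:: 1; 3; 2]; [:: 2; 3; 1]].

Local Open Scope ring_scope.

(* Formal power series, given by their coefficients. *)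
Definition fps := nat -> rat.

Definition fps_one : fps := fun n => (n == 0%N)%:R.

Definition fps_sub (a b : fps) : fps := fun n => a n - b n.

Definition fps_mul (a b : fps) : fps :=
  fun n => \sum_(k < n.+1) a k * b (n - k)%N.

(* The coefficients b_n, ..., b_0 of 1 / a, in this order. *)
Fixpoint fps_inv_rev (a : fps) (n : nat) : seq rat :=
  if n is m.+1 then
    let s := fps_inv_rev a m in
    (- (a 0%N)^-1 * \sum_(k < m.+1) a k.+1 * s`_k) :: s
  else [:: (a 0%N)^-1].

(* The multiplicative inverse of a when a 0 != 0, see fps_mulV. *)
Definition fps_inv (a : fps) : fps := fun n => head 0 (fps_inv_rev a n).

Definition fps_div (a b : fps) : fps := fps_mul a (fps_inv b).

Definition fps_sin : fps :=
  fun n => if odd n then (-1) ^+ n./2 / n`!%:R else 0.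

Definition fps_cos : fps :=
  fun n => if odd n then 0 else (-1) ^+ n./2 / n`!%:R.

Definition fps_sinh : fps := fun n => if odd n then n`!%:R^-1 else 0.

Definition fps_cosh : fps := fun n => if odd n then 0 else n`!%:R^-1.

Definition fps_tan : fps := fps_div fps_sin fps_cos.

Definition fps_tanh : fps := fps_div fps_sinh fps_cosh.

(* tan t is the sum of the tangent_number n * t^n / n! over the odd n; the
   coefficients of even index vanish by fps_tan_even. *)
Definition tangent_number (n : nat) : rat := n`!%:R * fps_tan n.

Definition egf_avoiding (P : seq word) : fps :=
  fun n => if n is 0%N then 1 else (num_avoiding P n)%:R / n`!%:R.

Local Close Scope ring_scope.

Lemma size_st s : size (st s) = size s.
Proof. by rewrite size_map. Qed.

Lemma st_mono (s : word) i r : i < size s -> r < size s ->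
  (nth 0 s i < nth 0 s r) = (nth 0 (st s) i < nth 0 (st s) r).
Proof.
move=> hi hr; rewrite !(nth_map 0) // ltnS.
set a := nth 0 s i; set b := nth 0 s r.
case: (ltnP a b) => hab; apply/esym.
  have ha : a \in s by apply: mem_nth.
  have -> : count (fun y => y < b) s =
    count (fun y => y < a) s + count (fun y => a <= y < b) s.
    rewrite -count_predUI -[LHS]addn0; congr (_ + _).
      by apply: eq_count => y /=; case: (ltnP y a) => //= h; rewrite (ltn_trans h hab).
    by apply/esym/eqP; rewrite -leqn0 leqNgt -has_count; apply/hasPn => y _ /=;
      case: (ltnP y a).
  rewrite -[X in X < _]addn0 ltn_add2l -has_count; apply/hasP; exists a => //=.
  by rewrite leqnn.
by apply/negbTE; rewrite -leqNgt; apply: sub_count => y /= h; apply: leq_trans hab.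
Qed.

Lemma st_perm (s : word) : uniq s -> perm_eq (st s) (iota 1 (size s)).
Proof.
move=> us.
have ust : uniq (st s).
  apply/(uniqP 0) => i j; rewrite !inE size_st => hi hj e.
  apply/eqP; rewrite -(nth_uniq 0 hi hj us).
  by case: ltngtP => //; rewrite st_mono // e ltnn.
apply: uniq_perm (iota_uniq _ _) _ => //.
apply: (uniq_min_size ust _ _).2; last by rewrite size_iota size_st.
move=> x /mapP [y ys ->]; rewrite mem_iota /= add1n ltnS.
rewrite -(count_predC (fun z => z < y)) -[X in X < _]addn0 ltn_add2l -has_count.
by apply/hasP; exists y => //=; rewrite ltnn.
Qed.

Lemma st_unique (s rho : word) :
  perm_eq rho (iota 1 (size s)) ->
  (forall i r, i < size s -> r < size s ->
     (nth 0 s i < nth 0 s r) = (nth 0 rho i < nth 0 rho r)) ->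
  st s = rho.
Proof.
move=> hp hm.
have sz : size rho = size s by rewrite (perm_size hp) size_iota.
apply: (@eq_from_nth _ 0); first by rewrite size_st.
move=> i; rewrite size_st => hi; rewrite (nth_map 0) //.
have -> : count (fun y => y < nth 0 s i) s = count (fun y => y < nth 0 rho i) rho.
  have cntE (u : word) x :
      count (fun y => y < x) u = count (fun k => nth 0 u k < x) (iota 0 (size u)).
    by rewrite -{1}(mkseq_nth 0 u) /mkseq count_map.
  rewrite !cntE sz; apply: eq_in_count => k; rewrite mem_iota /= add0n => hk.
  exact: hm.
rewrite (seq.permP hp).
have : nth 0 rho i \in iota 1 (size s) by rewrite -(perm_mem hp) mem_nth ?sz.
rewrite mem_iota add1n ltnS; move: (nth 0 rho i) => [//|a] /= ha.
have {1}-> : size s = a + (size s - a) by rewrite subnKC // ltnW.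
congr S; rewrite iotaD count_cat.
rewrite (@eq_in_count _ _ predT (iota 1 a)); last first.
  by move=> y; rewrite mem_iota add1n => /andP[_ ->].
rewrite count_predT size_iota (@eq_in_count _ _ pred0) ?count_pred0 ?addn0 //.
move=> y; rewrite mem_iota add1n => /andP[h _] /=.
by rewrite ltnNge h.
Qed.

Local Open Scope ring_scope.

Lemma size_fps_inv_rev a n : size (fps_inv_rev a n) = n.+1.
Proof. by elim: n => //= n ->. Qed.

Lemma nth_fps_inv_rev a n k : (k <= n)%N ->
  (fps_inv_rev a n)`_k = fps_inv a (n - k)%N.
Proof.
elim: n k => [|n IH] [|k] //= h; first by rewrite subSS IH.
Qed.

Lemma fps_mulV a : a 0%N != 0 -> fps_mul a (fps_inv a) =1 fps_one.
Proof.
move=> a0 [|n]; rewrite /fps_mul big_ord_recl /=.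
  by rewrite big_ord0 addr0 /fps_inv /= divff.
rewrite subn0 [fps_inv a n.+1]/fps_inv /= mulrA mulrN divff // mulN1r.
apply/eqP; rewrite addrC subr_eq0; apply/eqP; apply: eq_bigr => k _.
by rewrite nth_fps_inv_rev -1?ltnS // /bump /= add1n subSS.
Qed.

Lemma fps_cos_inv_odd n : odd n -> fps_inv fps_cos n = 0.
Proof.
elim/ltn_ind: n => -[//|n] IH on.
rewrite /fps_inv /= big1 ?mulr0 // => k _.
rewrite nth_fps_inv_rev -1?ltnS //.
case ok: (odd k.+1); first by rewrite /fps_cos ok mul0r.
rewrite IH ?mulr0 //; first by rewrite ltnS leq_subr.
by rewrite -subSS oddB ?on ?ok // ltnW // ltnS.
Qed.

Lemma fps_tan_even n : ~~ odd n -> fps_tan n = 0.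
Proof.
move=> en; rewrite /fps_tan /fps_div /fps_mul big1 // => k _.
case ok: (odd k); last by rewrite /fps_sin ok mul0r.
by rewrite fps_cos_inv_odd ?mulr0 // oddB ?ok ?(negbTE en) // -ltnS.
Qed.

(* Main.v *)
(* For words with distinct letters, the occurrences of 132 and 231 are the peaks.
   Hence the (l+1)-chains are the words x_1 < x_2 > x_3 < ... > x_(2l+1), and the
   avoiders are the words that decrease and then increase.

   Both families are described by their descents, and the Lehmer code
   c_i = #{j > i | x_j < x_i} is a bijection from the permutations onto the words
   with c_i <= n - i which preserves the descents. So one counts codes, building
   them from right to left and keeping track of the first entry.

   For the tangent numbers, let A_m (m odd) count the alternating words of length
   m, and F_(m,j) the words of length m + j that consist of an increasing run of j
   letters continued by an ascent into an alternating word of length m. When j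
   is even and positive, the words made of an increasing run of length j and an
   alternating word of length m, with no condition at the junction, are counted
   by F_(m,j) + F_(m+2,j-2), and also by 'C(m+j, j) A_m. The alternating sum of
   these identities telescopes to F_(1,n-1) = 1, which says A * cos = sin.

   The avoiders of length n + 1 are 2^n, and
   1 / (1 - tanh t) = cosh t / (cosh t - sinh t) = e^t cosh t. *)

Require Import Defs.
From mathcomp Require Import all_boot all_order all_algebra all_fingroup.
From mathcomp Require Import boolp zify ring.

Set Implicit Arguments.
Unset Strict Implicit.
Unset Printing Implicit Defensive.

Import GRing.Theory Num.Theory.
Local Open Scope nat_scope.

(** * Lehmer codes *)

Fixpoint lehmer (w : word) : word :=
  if w is x :: w' then count (fun y => y < x) w' :: lehmer w' else [::].

Fixpoint codes (n : nat) : seq word :=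
  if n is m.+1 then [seq k :: c | c <- codes m, k <- iota 0 m.+1]
  else [:: [::]].

Lemma codesS n : codes n.+1 = [seq k :: c | c <- codes n, k <- iota 0 n.+1].
Proof. by []. Qed.

Lemma size_codes n : size (codes n) = n`!.
Proof.
by elim: n => // n IH; rewrite codesS size_allpairs size_iota IH factS mulnC.
Qed.

Lemma lehmer_in_codes w : lehmer w \in codes (size w).
Proof.
elim: w => // x w IH; rewrite [size _]/= codesS; apply/allpairsP.
exists (lehmer w, count (fun y => y < x) w); split => //.
by rewrite mem_iota add0n ltnS count_size.
Qed.

(* The first letter is the element of the letter set whose rank is the first
   entry of the code. *)
Lemma lehmer_inj w1 w2 :
  uniq w1 -> perm_eq w1 w2 -> lehmer w1 = lehmer w2 -> w1 = w2.
Proof.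
elim: w1 w2 => [|x w1 IH] [|y w2] // u1 p12 /= [ec el].
have u2 : uniq (y :: w2) by rewrite -(perm_uniq p12).
have cE z (w : word) : count (fun t => t < z) (z :: w) = count (fun t => t < z) w.
  by rewrite /= ltnn.
have aux a b : a < b -> a \in y :: w2 ->
   count (fun t => t < a) (y :: w2) < count (fun t => t < b) (y :: w2).
  move=> ab ain.
  have -> : count (fun t => t < b) (y :: w2) =
     count (fun t => t < a) (y :: w2) + count (fun t => a <= t < b) (y :: w2).
    rewrite -count_predUI -[LHS]addn0; congr (_ + _).
      by apply: eq_count => t /=; lia.
    rewrite -[LHS](count_pred0 (y :: w2)); apply: eq_count => t /=; lia.
  rewrite -[X in X < _]addn0 ltn_add2l -has_count; apply/hasP; exists a => //=; lia.
have xin : x \in y :: w2 by rewrite -(perm_mem p12) mem_head.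
have exy : x = y.
  have := seq.permP p12 (fun t => t < x); rewrite cE ec -cE => e.
  case: (ltngtP x y) => // h.
    by have := aux _ _ h xin; rewrite -e ltnn.
  by have := aux _ _ h (mem_head _ _); rewrite -e ltnn.
subst y; congr (_ :: _); apply: IH => //; first by case/andP: u1.
by rewrite -(perm_cons x).
Qed.

(** If y < x, the letters of [w] below y are also below x, and y itself adds one; if x < y, the
    letters below x are among those below y. *)
Lemma lehmer_descent x y w : x != y ->
  (count (fun t => t < y) w < count (fun t => t < x) (y :: w)) = (y < x).
Proof.
move=> /=; case: (ltngtP y x) => // h _.
  by rewrite add1n ltnS; apply: sub_count => t /= ht; apply: ltn_trans h.
rewrite add0n; apply/negbTE; rewrite -leqNgt.
by apply: sub_count => t /= ht; apply: ltn_trans h.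
Qed.

(** * Counting permutations through their codes *)

Lemma perm_word_uniq n (s : 'S_n) : uniq (perm_word s).
Proof.
by rewrite map_inj_uniq ?enum_uniq // => i j [] /val_inj /perm_inj.
Qed.

Lemma size_perm_word n (s : 'S_n) : size (perm_word s) = n.
Proof. by rewrite size_map size_enum_ord. Qed.

Lemma perm_word_perm_eq n (s s' : 'S_n) : perm_eq (perm_word s) (perm_word s').
Proof.
have H (u : 'S_n) : perm_eq (perm_word u) [seq i.+1 | i : 'I_n <- enum 'I_n].
  rewrite /perm_word (map_comp (fun i : 'I_n => i.+1) u); apply: perm_map.
  apply: uniq_perm; rewrite ?enum_uniq //.
    by rewrite map_inj_uniq ?enum_uniq //; apply: perm_inj.
  move=> i; rewrite mem_enum; apply/mapP; exists (u^-1 i)%g; first by rewrite mem_enum.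
  by rewrite permKV.
by rewrite (perm_trans (H s)) // perm_sym.
Qed.

Lemma perm_word_inj n : injective (@perm_word n).
Proof.
move=> s s' e; apply/permP => i.
have sz : i < size (enum 'I_n) by rewrite size_enum_ord.
have := congr1 (fun w => nth 0 w i) e.
by rewrite /perm_word !(nth_map i 0 _ sz) nth_ord_enum => -[] /val_inj.
Qed.

Lemma card_perm_word n (Q : word -> Prop) (q : pred word) :
  (forall w, uniq w -> size w = n -> `[< Q w >] = q (lehmer w)) ->
  #|[set s : 'S_n | `[< Q (perm_word s) >]]| = count q (codes n).
Proof.
move=> H.
have pe : perm_eq [seq lehmer (perm_word s) | s <- enum 'S_n] (codes n).
  have u1 : uniq [seq lehmer (perm_word s) | s <- enum 'S_n].
    rewrite map_inj_uniq ?enum_uniq // => s s' e; apply: perm_word_inj.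
    exact: lehmer_inj (perm_word_uniq _) (perm_word_perm_eq _ _) e.
  have sub : {subset [seq lehmer (perm_word s) | s <- enum 'S_n] <= codes n}.
    move=> c /mapP [s _ ->].
    by have := lehmer_in_codes (perm_word s); rewrite size_perm_word.
  (* Both lists have n! entries, so the injection into [codes n] is onto. *)
  have sz : size (codes n) <= size [seq lehmer (perm_word s) | s <- enum 'S_n].
    by rewrite size_map -cardE card_Sn size_codes.
  apply: uniq_perm => //; first exact: leq_size_uniq u1 sub sz.
  by case: (uniq_min_size u1 sub sz).
rewrite -(seq.permP pe) count_map -sum1_card -sum1_count big_enum_cond /=.
apply: eq_bigl => s.
by rewrite inE H ?perm_word_uniq ?size_perm_word.
Qed.

(** * Alternating and valley-shaped words *)

(* Steps alternate between weak ascents and strict descents, the first one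
   being an ascent iff [b]. On a word with distinct letters the ascents are
   strict. *)
Fixpoint alternating (b : bool) (w : word) : bool :=
  if w is x :: w' then
    if w' is y :: _ then (b != (y < x)) && alternating (~~ b) w' else true
  else true.

(** Ascents are weak so that the predicate also applies to codes, whose entries may repeat. *)
Fixpoint valley (w : word) : bool :=
  if w is x :: w' then
    if w' is y :: _ then (if y < x then valley w' else sorted leq w') else true
  else true.

Lemma alternating_lehmer b w : uniq w -> alternating b (lehmer w) = alternating b w.
Proof.
elim: w b => //= x [|y w] // IH b /andP[nx uw].
rewrite [lehmer _]/= [count _ (y :: w)]/= -/lehmer.
have nxy : x != y by move: nx; rewrite inE negb_or => /andP[].
by rewrite -IH //= (lehmer_descent _ nxy).
Qed.

Lemma sorted_lehmer w : uniq w -> sorted leq (lehmer w) = sorted leq w.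
Proof.
elim: w => //= x [|y w] // IH /andP[nx uw].
have nxy : x != y by move: nx; rewrite inE negb_or => /andP[].
have /= IHw := IH uw.
by rewrite /= IHw; congr (_ && _); rewrite leqNgt (lehmer_descent _ nxy) -leqNgt.
Qed.

Lemma valley_lehmer w : uniq w -> valley (lehmer w) = valley w.
Proof.
elim: w => //= x [|y w] // IH /andP[nx uw].
have nxy : x != y by move: nx; rewrite inE negb_or => /andP[].
have /= IHw := IH uw; have /= Sw := sorted_lehmer uw.
by rewrite /= (lehmer_descent _ nxy) IHw Sw.
Qed.

Lemma alternating_rcons b x w y : alternating b (rcons (x :: w) y) =
  alternating b (x :: w) && ((b (+) odd (size w)) != (y < last x w)).
Proof.
elim: w b x => [|z w IH] b x /=; first by rewrite addbF andbT.
by move: (IH (~~ b) z) => /= ->; rewrite andbA addNb addbN.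
Qed.

(** * Occurrences of 132 and 231 are peaks *)

Definition peak_at (w : word) (i : nat) : bool :=
  [&& i + 3 <= size w, nth 0 w i < nth 0 w i.+1 & nth 0 w i.+2 < nth 0 w i.+1].

(** Of the six patterns of length 3, only 132 and 231 have their largest letter in the middle. *)
Lemma st3_peak a b c : uniq [:: a; b; c] ->
  (st [:: a; b; c] \in P132_231) = (a < b) && (c < b).
Proof.
move=> u; rewrite /P132_231 !inE /st.
move: u; rewrite /= !inE !negb_or !ltnn andbT => /andP[/andP[ab ac] bc].
by case: (ltngtP a b) ab; case: (ltngtP a c) ac => //;
   case: (ltngtP b c) bc => //; lia.
Qed.

Lemma peak_atP w i : uniq w ->
  reflect (exists2 p, p \in P132_231 & occurs_at p w i) (peak_at w i).
Proof.
move=> uw.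
have sz p : p \in P132_231 -> size p = 3.
  by rewrite !inE => /orP[] /eqP ->.
have E : i + 3 <= size w ->
    take 3 (drop i w) = [:: nth 0 w i; nth 0 w i.+1; nth 0 w i.+2].
  move=> h; have sz3 : size (take 3 (drop i w)) = 3.
    by rewrite size_takel // size_drop; lia.
  apply: (@eq_from_nth _ 0); rewrite sz3 //.
  by move=> [|[|[|k]]] // hk; rewrite nth_take // nth_drop /= ?addn0 ?addn1 ?addn2 //.
have U : i + 3 <= size w -> uniq [:: nth 0 w i; nth 0 w i.+1; nth 0 w i.+2].
  by move=> h; rewrite -E // take_uniq // drop_uniq.
apply: (iffP and3P) => [[h h1 h2]|[p pP /andP[]]].
  exists (st [:: nth 0 w i; nth 0 w i.+1; nth 0 w i.+2]).
    by rewrite st3_peak ?U // h1 h2.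
  by rewrite /occurs_at size_st [size _]/= h E /=.
rewrite (sz _ pP) => h; rewrite E // => /eqP e; move: pP; rewrite -e st3_peak ?U //.
by case/andP.
Qed.

Lemma peak_at_consS x w i : peak_at (x :: w) i.+1 = peak_at w i.
Proof. by []. Qed.

Lemma valleyP w : uniq w -> reflect (forall i, ~~ peak_at w i) (valley w).
Proof.
move=> uw; apply: (iffP idP) => [|H].
  elim: w {uw} => [|x [|y w] IH]; [by move=> _ [|[]] | by move=> _ [|[]] |].
  rewrite [valley _]/=; case: (ltnP y x) => [yx v|xy sw] [|i].
  - by rewrite /peak_at /= (ltnNge x) (ltnW yx) /= andbF.
  - by rewrite peak_at_consS IH.
  - rewrite /peak_at /=; case: w sw {IH} => [|z w] //= /andP[yz _].
    by rewrite !negb_and -!leqNgt yz !orbT.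
  - rewrite peak_at_consS; apply/negP => /and3P[h h1]; apply/negP; rewrite -leqNgt.
    by apply: (sorted_leq_nth leq_trans leqnn) => //; rewrite ?inE; lia.
elim: w uw H => [|x [|y w] IH] // /andP[nx uw] H.
have {IH} v : valley (y :: w) by apply: IH => // i; rewrite -(peak_at_consS x) H.
rewrite [valley _]/=; case: (ltnP y x) => // xy.
have {}xy : x < y.
  by rewrite ltn_neqAle xy andbT; move: nx; rewrite inE negb_or => /andP[].
(* If [y :: w] began with a descent, a peak would start at position 0; hence the valley [y :: w] is
   increasing. *)
case: w v {nx uw} H => [|z w] // v /(_ 0) H.
move: v; rewrite [valley _]/=; case: (ltnP z y) => [zy|yz s]; last by rewrite /= yz.
by move: H; rewrite /peak_at /= xy zy.
Qed.

Lemma avoids_valley w : uniq w -> `[< avoids P132_231 w >] = valley w.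
Proof.
move=> uw; apply/asboolP/(valleyP uw) => [H i|H p i pP].
  by apply/(peak_atP _ uw) => -[p pP]; apply/negP/H.
by apply: contra (H i) => o; apply/(peak_atP _ uw); exists p.
Qed.

(** * Chains are alternating words of odd length *)

Lemma links_peak t' t : uniq (t' ++ t) -> links P132_231 t' t <->
  exists i, [/\ peak_at (t' ++ t) i, i + 3 = size (t' ++ t), i < size t' &
                forall j, peak_at (t' ++ t) j -> j = i].
Proof.
move=> u; split.
  move=> [p [i [pP o sz it H]]]; exists i; split => //.
  - by apply/(peak_atP _ u); exists p.
  - by move: pP sz; rewrite !inE => /orP[] /eqP ->.
  - by move=> j /(peak_atP _ u)[p2 p2P o2]; case: (H _ _ p2P o2).
move=> [i [/(peak_atP _ u)[p pP o] sz it H]]; exists p, i.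
have sz3 r : r \in P132_231 -> size r = 3 by rewrite !inE => /orP[] /eqP ->.
split => //; first by rewrite sz3.
move=> p2 i2 p2P o2; have e : i2 = i by apply: H; apply/(peak_atP _ u); exists p2.
split => //; subst i2; move: o o2 => /andP[_ /eqP <-] /andP[_ /eqP <-].
by rewrite !sz3.
Qed.

Lemma links_letter x t : uniq (x :: t) -> links P132_231 [:: x] t <->
  exists y z, [/\ t = [:: y; z], x < y & z < y].
Proof.
move=> u; split.
  move/(links_peak (t' := [:: x]) u) => [[|i] [//= p sz _ _]].
  case: t sz u p => [|y [|z [|a t]]] //= _ u /and3P[_ /= h1 h2].
  by exists y, z.
move=> [y [z [e xy zy]]]; subst t; apply/links_peak => //.
exists 0; split => //; first by rewrite /peak_at /= xy zy.
by move=> [|j] // /and3P[]; rewrite /=; lia.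
Qed.

(** After the first link every tail is a two-letter descent. No peak starts at its first letter, so
    the linked one starts at its last. *)
Lemma links_descent a b t : b < a -> uniq [:: a, b & t] ->
  links P132_231 [:: a; b] t <-> exists y z, [/\ t = [:: y; z], b < y & z < y].
Proof.
move=> ba u; split.
  move/(links_peak (t' := [:: a; b]) u) => [[|[|i]] [//= p sz _ _]].
    by move: p => /and3P[_ /=]; lia.
  case: t sz u p => [|y [|z [|c t]]] //= _ u /and3P[_ /= h1 h2].
  by exists y, z.
move=> [y [z [e yb zy]]]; subst t; apply/links_peak => //.
exists 1; split => //; first by rewrite /peak_at /= yb zy.
by move=> [|[|j]] // /and3P[]; rewrite /=; lia.
Qed.

(** [x :: w] has an even number of steps, so the next step is an ascent again. *)
Lemma alternating_cat2 x w y z : ~~ odd (size w) ->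
  alternating true (x :: w ++ [:: y; z]) =
  [&& alternating true (x :: w), last x w <= y & z < y].
Proof.
move=> ev; rewrite -cat1s -cat_rcons catA cats1 -rcons_cat cat1s.
rewrite !alternating_rcons last_rcons size_rcons /= (negbTE ev) /= -andbA.
by rewrite ltnNge; case: (_ <= y); case: (z < y).
Qed.

(** The shape of the tail is part of the induction: it decides which letter the next peak starts
    from, namely the last one. *)
Lemma chain_alternating q s t : chain_tail P132_231 q.+1 s t -> uniq s ->
  [/\ size s = q.*2.+1, alternating true s &
     (exists2 x, s = [:: x] & t = [:: x]) \/
     (exists s0 y z, [/\ s = s0 ++ [:: y; z], t = [:: y; z] & z < y])].
Proof.
move eq1: q.+1 => q1 c.
elim: c q eq1 => [//|x q [->] _|{}q1 s' t' {}t q0 _ IH lk q [eq1] u].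
  by split => //; left; exists x.
case: q eq1 q0 => [<-//|q] eq1 _.
have us' : uniq s' by move: u; rewrite cat_uniq => /andP[].
have [ssz sa st'] := IH _ eq1 us'.
case: s' us' u ssz sa st' {IH} => // a s' us' u [ssz] sa st'.
have ev : ~~ odd (size s') by rewrite ssz odd_double.
have [y [z [et yl zy]]] : exists y z, [/\ t = [:: y; z], last a s' < y & z < y].
  case: st' => [[x [ea es'] et']|[s0 [b [c [es et' cb]]]]]; subst t'.
    by subst; move/links_letter: lk; apply.
  rewrite es in u; move: (u); rewrite -catA cat_uniq => /and3P[_ _ u2].
  move/(links_descent cb u2): lk => [y [z [e h1 h2]]].
  exists y, z; split => //; rewrite -[last a s']/(last a (a :: s')) es.
  by rewrite last_cat.
subst t; split; last by right; exists (a :: s'), y, z.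
  by rewrite size_cat /= ssz; lia.
by rewrite cat_cons alternating_cat2 // sa (ltnW yl) zy.
Qed.

Lemma alternating_chain q s : uniq s -> size s = q.*2.+1 -> alternating true s ->
  is_chain P132_231 q.+1 s.
Proof.
elim: q s => [|q IH] s u sz al.
  by case: s sz {u al} => [|x []] // _; exists [:: x]; constructor.
have [a [s' [y [z es]]]] : exists a s' y z, s = a :: s' ++ [:: y; z].
  case/lastP: s sz {u al} => // s z; case/lastP: s => // s y; case: s => // a s _.
  by exists a, s, y, z; rewrite -!cats1 -!catA.
subst s; have sz' : size (a :: s') = q.*2.+1.
  by move: sz; rewrite /= size_cat /=; lia.
have ev : ~~ odd (size s') by case: sz' => ->; rewrite odd_double.
move: al; rewrite alternating_cat2 // => /and3P[al yl zy].
have us' : uniq (a :: s') by move: u; rewrite -cat_cons cat_uniq => /andP[].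
have [t' c] := IH _ us' sz' al.
exists [:: y; z]; rewrite -cat_cons; apply: (chain_link _ c) => //.
have {}yl : last a s' < y.
  rewrite ltn_neqAle yl andbT; apply/eqP => e.
  move: u; rewrite -cat_cons cat_uniq => /and3P[_ /hasPn/(_ y)].
  by rewrite mem_head -e mem_last => /(_ isT).
(* The tail given by induction is a single letter or a descent, and y z links to either one. *)
have [_ _] := chain_alternating c us'.
case=> [[x [ea es'] et']|[s0 [b [d [es et' db]]]]]; subst t'.
  by subst; apply/links_letter => //; exists y, z.
have ub : uniq [:: b, d, y & [:: z]].
  by move: u; rewrite -cat_cons es -catA cat_uniq => /and3P[].
apply/links_descent => //; exists y, z; split => //.
by move: yl; rewrite -[last a s']/(last a (a :: s')) es last_cat.
Qed.

Lemma is_chain_alternating q s : uniq s ->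
  `[< is_chain P132_231 q.+1 s >] = (size s == q.*2.+1) && alternating true s.
Proof.
move=> u; apply/asboolP/andP => [[t c]|[/eqP]]; last exact: alternating_chain.
by case: (chain_alternating c u) => ->.
Qed.

(** * Counting codes *)

Definition codes_with_head (R : pred word) (n k : nat) : nat :=
  \sum_(c <- codes n) R (k :: c).

Lemma count_codesS R n :
  count R (codes n.+1) = \sum_(k < n.+1) codes_with_head R n k.
Proof.
rewrite codesS -sum1_count big_mkcond big_allpairs_dep exchange_big.
rewrite -[iota 0 n.+1]/(index_iota 0 n.+1) big_mkord.
by apply: eq_bigr => k _; apply: eq_bigr => c _ /=; case: (R _).
Qed.

Lemma codes_with_headS R n k : codes_with_head R n.+1 k =
  \sum_(i < n.+1) codes_with_head (fun c => R (k :: c)) n i.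
Proof.
rewrite -count_codesS -sum1_count big_mkcond.
by apply: eq_bigr => c _; case: (R _).
Qed.

Definition alt_count (b : bool) := codes_with_head (alternating b).

Lemma alt_count0 b k : alt_count b 0 k = 1.
Proof. by rewrite /alt_count /codes_with_head big_seq1. Qed.

Lemma alt_countS b n k :
  alt_count b n.+1 k = \sum_(i < n.+1 | b != (i < k)) alt_count (~~ b) n i.
Proof.
rewrite /alt_count codes_with_headS [RHS]big_mkcond; apply: eq_bigr => i _.
rewrite /codes_with_head /=; case: (b != _) => //=; exact: big1.
Qed.

(** The last entry of a code is 0, so a weakly increasing code vanishes identically. *)
Lemma sorted_count n k : k <= n ->
  codes_with_head (sorted leq) n k = (k == 0).
Proof.
elim: n k => [|n IH] k kn.
  by rewrite /codes_with_head big_seq1; case: k kn.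
rewrite codes_with_headS.
rewrite (eq_bigr (fun i : 'I_n.+1 => (k <= i) * (i == 0 :> nat))).
  by rewrite big_ord_recl /= muln1 big1 ?addn0 ?leqn0 // => i _; rewrite muln0.
move=> i _; have le_in : i <= n by rewrite -ltnS.
rewrite -IH // /codes_with_head big_distrr /=.
by apply: eq_bigr => c _; rewrite mulnb.
Qed.

(** A first ascent forces k = 0, since the remaining code is increasing, hence zero. For k > 0 the
    second entry i is below k; as [0.-1] is 0, the sum is 1 + 1 + 2 + ... + 2^(k-2). *)
Lemma valley_count n k : k <= n -> codes_with_head valley n k = 2 ^ k.-1.
Proof.
elim: n k => [|n IH] k kn.
  by rewrite /codes_with_head big_seq1; case: k kn.
rewrite codes_with_headS.
rewrite (eq_bigr (fun i : 'I_n.+1 =>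
           (if i < k then 2 ^ i.-1 else 0) + (if k <= i then (i == 0 :> nat) : nat else 0))).
  rewrite big_split /= -!big_mkcond -(big_ord_widen _ (fun i => 2 ^ i.-1)) //=.
  rewrite [X in _ + X]big_mkcond [X in _ + X]big_ord_recl.
  rewrite [X in _ + (_ + X)]big1 => [|i _]; last by rewrite if_same.
  case: k kn => [|k] _; rewrite ?big_ord0 //= !addn0.
  elim: k => [|k IHk]; first by rewrite big_ord_recl big_ord0.
  by rewrite big_ord_recr /= IHk addnn -mul2n -expnS.
move=> i _; have le_in : i <= n by rewrite -ltnS.
rewrite -IH // -(sorted_count le_in) /codes_with_head /=.
by case: (ltnP i k) => h; rewrite ?addn0.
Qed.

(** * Alternating words preceded by an increasing run *)

(* If [f k] counts words of length n + 1 by the first entry k of their code, then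
   [add_ascent n f] counts in this way the words of length n + 2 obtained by
   prepending a smaller letter. *)
Definition add_ascent (n : nat) (f : nat -> nat) (k : nat) : nat :=
  \sum_(i < n.+1 | k <= i) f i.

(** Each prepended letter enlarges the range of the first code entry by one, hence [n.+1] in the
    recursive call. *)
Fixpoint add_ascents (n j : nat) (f : nat -> nat) : nat -> nat :=
  if j is j'.+1 then add_ascents n.+1 j' (add_ascent n f) else f.

Definition total (n : nat) (f : nat -> nat) : nat := \sum_(i < n.+1) f i.

Lemma total_add_ascent n f : total n f = add_ascent n f 0.
Proof. by apply: eq_bigl. Qed.

Lemma eq_add_ascent n f g : (forall k, k <= n -> f k = g k) ->
  add_ascent n f =1 add_ascent n g.
Proof. by move=> e k; apply: eq_bigr => i _; rewrite e // -ltnS. Qed.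

Lemma eq_add_ascents n j f g : (forall k, k <= n -> f k = g k) ->
  forall k, k <= n + j -> add_ascents n j f k = add_ascents n j g k.
Proof.
elim: j n f g => [|j IH] n f g e k; first by rewrite addn0; apply: e.
by rewrite addnS -addSn => /IH; apply => i _; apply: eq_add_ascent.
Qed.

Lemma eq_total n f g : (forall k, k <= n -> f k = g k) -> total n f = total n g.
Proof. by rewrite !total_add_ascent => /eq_add_ascent. Qed.

Lemma totalD n f g : total n f + total n g = total n (fun i => f i + g i).
Proof. by rewrite /total big_split. Qed.

Lemma add_ascentsD n j f g k : add_ascents n j (fun i => f i + g i) k =
  add_ascents n j f k + add_ascents n j g k.
Proof.
elim: j n f g k => [|j IH] n f g k //=; rewrite -IH.
suff E : add_ascent n (fun i => f i + g i) =
         (fun i => add_ascent n f i + add_ascent n g i) by rewrite E.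
by apply: funext => i; rewrite /add_ascent big_split.
Qed.

(** The hockey-stick identity. *)
Lemma add_ascent_bin n r c k :
  add_ascent n (fun i => c * 'C(n - i, r)) k = c * 'C(n.+1 - k, r.+1).
Proof.
rewrite /add_ascent -big_distrr /=; congr (_ * _).
elim: n k => [|n IH] k.
  rewrite big_mkcond big_ord_recl big_ord0 /=.
  by case: k => [|k] //=; rewrite ?sub1n; case: r.
rewrite big_mkcond big_ord_recl; case: k => [|k] /=.
  by rewrite !subn0 binS addnC; have := IH 0; rewrite subn0 => <-.
by rewrite add0n -big_mkcond subSS -IH.
Qed.

Lemma add_ascents_bin n j r c k :
  add_ascents n j (fun i => c * 'C(n - i, r)) k = c * 'C(n + j - k, r + j).
Proof.
elim: j n r => [|j IH] n r /=; first by rewrite !addn0.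
suff -> : add_ascent n (fun i => c * 'C(n - i, r)) = (fun i => c * 'C(n.+1 - i, r.+1)).
  by rewrite IH addSnnS addSnnS.
by apply: funext => i; rewrite add_ascent_bin.
Qed.

(** A constant is a multiple of 'C(n - i, 0), and the hockey-stick identity applies j + 1 times. *)
Lemma total_add_ascents_const n j c :
  total (n + j) (add_ascents n j (fun _ => c)) = c * 'C((n + j).+1, j.+1).
Proof.
have -> : (fun _ : nat => c) = (fun i => c * 'C(n - i, 0)).
  by apply: funext => i; rewrite bin0 muln1.
rewrite (@eq_total _ _ (fun i => c * 'C(n + j - i, j))) => [|k _]; last first.
  by rewrite add_ascents_bin.
by rewrite total_add_ascent add_ascent_bin subn0.
Qed.

(** * The alternating sum identity *)

Definition alt_number (n : nat) : nat := count (alternating true) (codes n).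

(** This is F_(m,j) with m = 2l + 1. *)
Definition run_alt_count (l j : nat) : nat :=
  total (l.*2 + j) (add_ascents l.*2 j (alt_count true l.*2)).

Lemma alt_numberE l : alt_number l.*2.+1 = total l.*2 (alt_count true l.*2).
Proof. exact: count_codesS. Qed.

Lemma run_alt_count0 l : run_alt_count l 0 = alt_number l.*2.+1.
Proof. by rewrite alt_numberE /run_alt_count addn0. Qed.

Lemma run_alt_count_single j : run_alt_count 0 j = 1.
Proof.
rewrite /run_alt_count (@eq_total _ _ (add_ascents 0 j (fun _ => 1))).
  by rewrite total_add_ascents_const binn.
by move=> k kj; apply: eq_add_ascents => // i _; rewrite alt_count0.
Qed.

(* Between the run and the alternating word the step is either an ascent, or a
   descent, and in this case the last two letters of the run can be moved to
   the alternating word. *)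
Lemma run_alt_countSS l j : run_alt_count l j.+2 + run_alt_count l.+1 j =
  alt_number l.*2.+1 * 'C((l.+1).*2 + j.+1, j.+2).
Proof.
pose f := alt_count true l.*2.
have E1 k : k <= l.*2.+2 -> alt_count true l.+1.*2 k =
    add_ascent l.*2.+1 (fun i => alt_count false l.*2.+1 i) k.
  by rewrite doubleS alt_countS => _; apply: eq_bigl => i; rewrite ltnNge; case: (k <= i).
(* The first letter of the alternating word joins the run; what follows begins with a descent. *)
have -> : run_alt_count l.+1 j =
    total (l.*2.+1 + j.+1) (add_ascents l.*2.+1 j.+1 (alt_count false l.*2.+1)).
  rewrite /run_alt_count doubleS addSnnS; apply: eq_total => k kj.
  by apply: eq_add_ascents; last lia; move=> i hi; rewrite -E1.
have -> : run_alt_count l j.+2 =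
    total (l.*2.+1 + j.+1) (add_ascents l.*2.+1 j.+1 (add_ascent l.*2 f)).
  by rewrite /run_alt_count addSnnS.
rewrite totalD (@eq_total _ _ (add_ascents l.*2.+1 j.+1 (fun _ => alt_number l.*2.+1))).
  by rewrite total_add_ascents_const doubleS; congr (_ * 'C(_, _)); lia.
(* Below the last letter of the run, of code entry i, ascent and descent together allow every
   alternating word, whatever i is. *)
move=> k kj; rewrite -[LHS](add_ascentsD l.*2.+1 j.+1); apply: eq_add_ascents => // i hi.
rewrite alt_numberE alt_countS /= /total [RHS](bigID (fun t : 'I__ => i <= t)) /=.
by congr (_ + _); apply: eq_bigl => t; rewrite ltnNge; case: (i <= t).
Qed.

Local Open Scope ring_scope.

(** Iterating [run_alt_countSS] moves two letters at a time from the run to the alternating word,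
    with a change of sign. *)
Lemma alt_number_sum l r :
  \sum_(i < r.+1) (-1) ^+ i *
     (alt_number (l + i).*2.+1 * 'C((l + r).*2.+1, (r - i).*2))%:R
  = (run_alt_count l r.*2)%:R :> rat.
Proof.
elim: r l => [|r IH] l.
  by rewrite big_ord_recl big_ord0 addr0 !addn0 mul1r bin0 muln1 run_alt_count0.
rewrite big_ord_recl mul1r addn0 subn0.
rewrite (eq_bigr (fun i : 'I_r.+1 => - ((-1) ^+ i *
     (alt_number (l.+1 + i).*2.+1 * 'C((l.+1 + r).*2.+1, (r - i).*2))%:R))).
  rewrite sumrN IH; apply/eqP; rewrite subr_eq -natrD eqr_nat doubleS run_alt_countSS.
  by apply/eqP; congr (_ * 'C(_, _))%N; lia.
by move=> i _; rewrite /= /bump /= add1n subSS exprS mulN1r mulNr !addSnnS.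
Qed.

(** * Formal power series *)

(** Truncation to polynomials transfers the ring laws to series, coefficient by coefficient. *)
Lemma fps_mulE a b n m : (m <= n)%N ->
  fps_mul a b m = ((\poly_(i < n.+1) a i) * (\poly_(i < n.+1) b i))`_m.
Proof.
move=> mn; rewrite coefM; apply: eq_bigr => k _; rewrite !coef_poly.
by rewrite !ifT //; have := ltn_ord k; lia.
Qed.

Lemma fps_mulA a b c : fps_mul a (fps_mul b c) = fps_mul (fps_mul a b) c.
Proof.
apply: funext => n; pose p (f : fps) := \poly_(i < n.+1) f i.
transitivity ((p a * (p b * p c))`_n).
  rewrite coefM; apply: eq_bigr => k _; have := ltn_ord k => kn.
  by rewrite coef_poly kn (fps_mulE _ _ (leq_subr _ _)).
rewrite mulrA coefM; apply: eq_bigr => k _; have := ltn_ord k => kn.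
by rewrite coef_poly ltnS leq_subr (@fps_mulE _ _ n) // -ltnS.
Qed.

Lemma fps_mulC a b : fps_mul a b = fps_mul b a.
Proof. by apply: funext => n; rewrite !(fps_mulE _ _ (leqnn n)) mulrC. Qed.

Lemma fps_mul1 a : fps_mul a fps_one = a.
Proof.
apply: funext => n; rewrite /fps_mul big_ord_recr /= subnn mulr1.
rewrite big1 ?add0r // => k _; rewrite /fps_one.
by rewrite subn_eq0 leqNgt ltn_ord mulr0.
Qed.

Lemma fps_divP a b c : b 0%N != 0 -> fps_mul c b = a -> fps_div a b = c.
Proof.
move=> b0 <-; rewrite /fps_div -fps_mulA.
by rewrite (funext (fps_mulV b0)) fps_mul1.
Qed.

Lemma fps_divK a b : b 0%N != 0 -> fps_mul (fps_div a b) b = a.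
Proof.
move=> b0; rewrite /fps_div -fps_mulA [fps_mul (fps_inv b) b]fps_mulC.
by rewrite (funext (fps_mulV b0)) fps_mul1.
Qed.

Lemma fps_invP a b : a 0%N != 0 -> fps_mul b a = fps_one -> fps_inv a = b.
Proof.
move=> a0 /(fps_divP a0) <-.
by rewrite /fps_div fps_mulC fps_mul1.
Qed.

Lemma fps_mulDl a b c n :
  fps_mul (fun i => a i + b i) c n = fps_mul a c n + fps_mul b c n.
Proof. by rewrite -big_split; apply: eq_bigr => k _; rewrite mulrDl. Qed.

Lemma fps_mulZl x a c n : fps_mul (fun i => x * a i) c n = x * fps_mul a c n.
Proof. by rewrite /fps_mul big_distrr; apply: eq_bigr => k _; rewrite /= mulrA. Qed.

(** * Exponential and hyperbolic series *)

Definition fps_exp (x : rat) : fps := fun n => x ^+ n / n`!%:R.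

Lemma natr_fact_neq0 n : n`!%:R != 0 :> rat.
Proof. by rewrite pnatr_eq0 -lt0n fact_gt0. Qed.

Lemma bin_div_fact n k : (k <= n)%N ->
  'C(n, k)%:R / n`!%:R = (k`!%:R)^-1 * ((n - k)`!%:R)^-1 :> rat.
Proof.
move=> kn; rewrite -(bin_fact kn) !natrM.
have nz : 'C(n, k)%:R != 0 :> rat by rewrite pnatr_eq0 -lt0n bin_gt0.
by field; rewrite nz !natr_fact_neq0.
Qed.

Lemma fps_expD x y : fps_mul (fps_exp x) (fps_exp y) = fps_exp (x + y).
Proof.
apply: funext => n; rewrite /fps_exp addrC exprDn big_distrl /=.
apply: eq_bigr => k _; have kn : (k <= n)%N by rewrite -ltnS.
by rewrite -[_ *+ 'C(_, _)]mulr_natr -[RHS]mulrA bin_div_fact //; ring.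
Qed.

Lemma fps_exp0 : fps_exp 0 = fps_one.
Proof.
apply: funext => -[|n]; first by rewrite /fps_exp expr0 divr1.
by rewrite /fps_exp expr0n mul0r.
Qed.

Lemma fps_coshE n : fps_cosh n = 2%:R^-1 * (fps_exp 1 n + fps_exp (-1) n).
Proof.
rewrite /fps_cosh /fps_exp expr1n -signr_odd; case: (odd n) => /=;
  by field; apply: natr_fact_neq0.
Qed.

Lemma fps_cosh_sub_sinh : fps_sub fps_cosh fps_sinh = fps_exp (-1).
Proof.
apply: funext => n; rewrite /fps_sub /fps_cosh /fps_sinh /fps_exp -signr_odd.
by case: (odd n); rewrite /= ?expr1 ?expr0 ?mulN1r ?mul1r ?subr0 ?sub0r.
Qed.

Lemma fps_mul_subl a b c :
  fps_mul (fps_sub a b) c = fps_sub (fps_mul a c) (fps_mul b c).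
Proof.
by apply: funext => n; rewrite /fps_sub -sumrB; apply: eq_bigr => k _; rewrite mulrBl.
Qed.

Lemma fps_inv_one_sub_tanh :
  fps_inv (fps_sub fps_one fps_tanh) = fps_mul fps_cosh (fps_exp 1).
Proof.
have c0 : fps_cosh 0%N != 0 by [].
apply: fps_invP.
  by rewrite /fps_sub /fps_tanh /fps_div /fps_mul big_ord1 [fps_sinh _]/= mul0r subr0.
rewrite fps_mulC fps_mulA fps_mul_subl [fps_mul fps_one _]fps_mulC fps_mul1.
by rewrite fps_divK // fps_cosh_sub_sinh fps_expD addNr fps_exp0.
Qed.

(** * Coefficients of the two generating functions *)

Lemma num_avoidingE n : num_avoiding P132_231 n.+1 = (2 ^ n)%N.
Proof.
rewrite /num_avoiding (@card_perm_word _ _ valley) => [|w u _]; last first.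
  by rewrite avoids_valley // valley_lehmer.
rewrite count_codesS (eq_bigr (fun k : 'I_n.+1 => 2 ^ k.-1)%N) => [|k _]; last first.
  by rewrite valley_count // -ltnS.
elim: n => [|n IH]; first by rewrite big_ord_recl big_ord0.
by rewrite big_ord_recr /= IH addnn -mul2n -expnS.
Qed.

Lemma sum_ord_double (F : nat -> rat) m :
  \sum_(k < m.*2) F k = \sum_(i < m) (F i.*2 + F i.*2.+1).
Proof.
elim: m => [|m IH]; first by rewrite !big_ord0.
by rewrite doubleS 2!big_ord_recr /= IH big_ord_recr /= addrA.
Qed.

Lemma fps_tanE : fps_tan =
  fun n => if odd n then (alt_number n)%:R / n`!%:R else 0.
Proof.
apply: fps_divP => //; apply: funext => n; rewrite /fps_mul /fps_sin.
case on: (odd n); last first.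
  rewrite big1 // => k _; case ok: (odd k); last by rewrite mul0r.
  by rewrite /fps_cos oddB ?on ?ok ?mulr0 // -ltnS.
have -> : n = (n./2).*2.+1 by rewrite -[LHS]odd_double_half on.
move: {n on}(n./2) => L; rewrite -doubleS (sum_ord_double (fun k =>
  (if odd k then (alt_number k)%:R / k`!%:R else 0) * fps_cos (L.*2.+1 - k)%N)).
rewrite /= uphalf_double.
have := alt_number_sum 0 L; rewrite run_alt_count_single mulr1n => e.
(* The factor 1 is replaced by the alternating sum, so that both sides can be compared term by
   term. *)
rewrite -[RHS]mulr1 -[X in _ = _ * X]e mulrAC big_distrr /= big_distrl /=.
apply: eq_bigr => -[i iL'] _ /=; have iL : (i <= L)%N by rewrite -ltnS.
rewrite odd_double /= mul0r add0r !add0n subSS -doubleB /fps_cos odd_double doubleK.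
have -> : (-1) ^+ (L - i) = (-1) ^+ L * (-1) ^+ i :> rat.
  by rewrite -[in RHS](subnK iL) exprD -mulrA -expr2 sqrr_sign mulr1.
have h : (((L - i).*2 <= L.*2.+1)%N) by lia.
have := bin_div_fact h; rewrite (_ : (L.*2.+1 - (L - i).*2 = i.*2.+1)%N); last lia.
rewrite natrM => hb.
transitivity ((-1) ^+ L * (-1) ^+ i * (alt_number i.*2.+1)%:R *
   ('C(L.*2.+1, (L - i).*2)%:R / (L.*2.+1)`!%:R) : rat); first by rewrite hb; ring.
by ring.
Qed.

Lemma num_chainsE l n : num_chains P132_231 l.+1 n =
  if n == l.*2.+1 then alt_number n else 0%N.
Proof.
rewrite /num_chains.
rewrite (@card_perm_word _ _ (fun c => (n == l.*2.+1) && alternating true c)).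
  by case: eqP => //= _; rewrite (eq_count (a2 := pred0)) // count_pred0.
by move=> w u sz; rewrite is_chain_alternating // sz alternating_lehmer.
Qed.

Theorem theorem4p20 :
  let c := fun n l : nat => num_chains P132_231 (l + 1)%N n in
  [/\ forall n l : nat, (1 <= n)%N -> n <> (2 * l + 1)%N -> c n l = 0%N,
      forall l : nat,
        ((c (2 * l + 1)%N l)%:R = tangent_number (2 * l + 1))%R &
      forall n : nat,
        egf_avoiding P132_231 n = fps_inv (fps_sub fps_one fps_tanh) n].
Proof.
split=> [n l _ nE|l|n]; rewrite ?addn1 ?mul2n.
- by rewrite num_chainsE ifN //; apply/eqP; rewrite -mul2n -addn1.
- rewrite num_chainsE eqxx /tangent_number fps_tanE /= odd_double /=.
  by rewrite mulrC divfK // natr_fact_neq0.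
rewrite fps_inv_one_sub_tanh.
(* The series becomes (e^(2t) + 1) / 2, with coefficient 2^n / (n+1)! at n + 1 and 1 at 0. *)
rewrite (_ : fps_cosh = (fun n => 2%:R^-1 * (fps_exp 1 n + fps_exp (-1) n))); last first.
  by apply: funext => m; rewrite fps_coshE.
rewrite fps_mulZl fps_mulDl !fps_expD addNr fps_exp0 /fps_exp.
case: n => [|n] //=; rewrite num_avoidingE /fps_one /= addr0 mulrA natrX.
by rewrite exprS mulrA mulVf // mul1r.
Qed.
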